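(* Let $\Omega\subset\mathbb{R}^n$ be a non-empty, bounded, open set, let $W:\mathbb{R}^m\times\mathbb{R}^m\to\mathbb{R}$ be lower semicontinuous and coercive, i.e., $W(\xi,\zeta)\to\infty$ as $|(\xi,\zeta)|\to\infty$, and let $J(u):=\operatorname*{ess\,sup}_{(x,y)\in\Omega\times\Omega}W(u(x),u(y))$ for $u\in L^\infty(\Omega;\mathbb{R}^m)$. Suppose that for every $c\in\mathbb{R}$ the set $\widehat{L_c(W)}$ is compact and satisfies $$\widehat{\widehat{L_c(W)}^{\rm sc}}=\bigcup_{(\alpha,\beta)\in\widehat{L_c(W)}}Q_{\alpha,\beta}\qquad\text{with}\qquad \mathcal P_{\widehat{L_c(W)}^{\rm sc}}\subset\{Q_{\alpha,\beta}:(\alpha,\beta)\in\widehat{L_c(W)}\}.$$ Then $J$ is $L^\infty$-weakly$^\ast$ lower semicontinuous if and only if for all $c\in\mathbb{R}$, $$\widehat{\widehat{L_c(W)}^{\rm sc}}=\widehat{L_c(W)}.$$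
   Context: $L_c(W):=\{(\xi,\zeta)\in\mathbb{R}^m\times\mathbb{R}^m: W(\xi,\zeta)\le c\}$. For $E\subset\mathbb{R}^m\times\mathbb{R}^m$, $\widehat E:=\{(\xi,\zeta)\in E:(\xi,\xi),(\zeta,\xi),(\zeta,\zeta)\in E\}$. A set $E\subset\mathbb{R}^m\times\mathbb{R}^m$ is separately convex if for all $t\in(0,1)$ and all $(\xi_1,\zeta_1),(\xi_2,\zeta_2)\in E$ with $\xi_1=\xi_2$ or $\zeta_1=\zeta_2$ one has $t(\xi_1,\zeta_1)+(1-t)(\xi_2,\zeta_2)\in E$; $E^{\rm sc}$ is the smallest separately convex set containing $E$. $\widehat{L_c(W)}^{\rm sc}$ is the separately convex hull of $\widehat{L_c(W)}$, and $\widehat{\widehat{L_c(W)}^{\rm sc}}$ is the operation $\widehat{\ \cdot\ }$ applied to that hull. For $\alpha,\beta\in\mathbb{R}^m$, $[\alpha,\beta]:=\{t\alpha+(1-t)\beta: t\in[0,1]\}$ and $Q_{\alpha,\beta}:=[\alpha,\beta]\times[\alpha,\beta]$. $\mathcal P_E$ is the set of maximal Cartesian subsets of $E$: sets $P=A\times A\subset E$ with $\emptyset\neq A\subset\mathbb{R}^m$ such that $B=A$ for any $B\subset\mathbb{R}^m$ with $A\subset B$ and $B\times B\subset E$. $J$ takes values in $\mathbb{R}\cup\{\infty\}$; $L^\infty$-weakly$^\ast$ lower semicontinuous means $J(u)\le\liminf_{j\to\infty}J(u_j)$ whenever $u_j\rightharpoonup^\ast u$ in $L^\infty(\Omega;\mathbb{R}^m)$.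 *)

(* Defs.v *)
From HB Require Import structures.
From mathcomp Require Import all_boot all_order all_algebra.
From mathcomp Require Import all_classical all_reals all_analysis.
From mathcomp Require Import measurable_realfun ess_sup_inf.

Set Implicit Arguments.
Unset Strict Implicit.
Unset Printing Implicit Defensive.

Import Order.TTheory GRing.Theory Num.Theory.
Import numFieldNormedType.Exports.

Local Open Scope classical_set_scope.
Local Open Scope ring_scope.

(** R^n is modelled by row vectors, with the Borel sigma-algebra. *)

Section borel_rV.
Context {R : realType} {n : nat}.

Let borel : set (set 'rV[R]_n) := <<s open >>.

Let borel0 : borel set0.
Proof. exact: sigma_algebra0. Qed.

Let borelC A : borel A -> borel (~` A).
Proof. exact: sigma_algebraC. Qed.

Let borel_bigcup (F : (set 'rV[R]_n)^nat) :
  (forall i, borel (F i)) -> borel (\bigcup_i F i).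
Proof. exact: sigma_algebra_bigcup. Qed.

HB.instance Definition _ := @isMeasurable.Build
  (sigma_display (@open 'rV[R]_n)) 'rV[R]_n borel borel0 borelC borel_bigcup.

Lemma open_measurable_rV (U : set 'rV[R]_n) : open U -> measurable U.
Proof. exact: sub_sigma_algebra. Qed.

Lemma measurable_coord (i : 'I_n) :
  measurable_fun [set: 'rV[R]_n] (fun x => x ord0 i).
Proof.
apply: (measurability _ (RGenOpens.measurableE R)).
move=> _ [_ [a [b ->] <-]]; rewrite setTI.
apply: open_measurable_rV; apply: open_comp; last exact: interval_open.
by move=> x _; exact: coord_continuous.
Qed.

Let rball (q : 'rV[rat]_n * nat) : set 'rV[R]_n :=
  ball (map_mx ratr q.1 : 'rV[R]_n) q.2.+1%:R^-1.

Let open_bigcup_rball (U : set 'rV[R]_n) : open U ->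
  U = \bigcup_(q in [set q | rball q `<=` U]) rball q.
Proof.
move=> oU; apply/seteqP; split => [x Ux|x [q /= qU /qU]//].
have /nbhs_ballP[e /= e0 xeU] : nbhs x U by exact: open_nbhs_nbhs.
have e20 : 0 < e / 2 by rewrite divr_gt0.
have [k ke] : exists k, (k.+1%:R^-1 : R) < e / 2.
  have [k _ /(_ k (leqnn k)) /= ?] := near_infty_natSinv_lt (PosNum e20).
  by exists k.
have k0 : (0 : R) < k.+1%:R^-1 by rewrite invr_gt0.
have /choice[f xf] : forall i, exists q : rat,
    `|ratr q - x ord0 i| < (k.+1%:R^-1 : R).
  move=> i.
  have := @rat_in_itvoo R (x ord0 i - k.+1%:R^-1) (x ord0 i + k.+1%:R^-1).
  case=> [|q]; first by rewrite ltrBlDr -addrA ltrDl addr_gt0.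
  by rewrite in_itv/= => qx; exists q; rewrite ltr_distl.
have xB : rball (\row_i f i, k) x.
  by split => // i j; rewrite !mxE ord1; exact: xf.
exists (\row_i f i, k) => //= y By.
apply: xeU; apply: (@le_ball _ _ _ (k.+1%:R^-1 + k.+1%:R^-1)).
  by rewrite [leRHS]splitr lerD// ltW.
by apply: ball_triangle By; exact: ball_sym.
Qed.

Lemma measurable_fun_rV d (T : measurableType d) (D : set T)
    (f : T -> 'rV[R]_n) :
  (forall i, measurable_fun D (fun x => f x ord0 i)) -> measurable_fun D f.
Proof.
move=> mf mD; suff : measurable_fun D f by exact.
apply: (@measurability _ _ _ _ D f (@open 'rV[R]_n) erefl).
move=> _ [U oU <-]; rewrite (open_bigcup_rball oU) preimage_bigcup.
rewrite setI_bigcupr bigcup_mkcond; apply: countable_bigcupT_measurable => //.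
move=> q; case: ifPn => // _.
have -> : D `&` f @^-1` rball q =
    D `&` \bigcap_(i in [set: 'I_n]) (D `&`
      (fun x => f x ord0 i) @^-1` ball (ratr (q.1 ord0 i) : R) q.2.+1%:R^-1).
  apply/seteqP; split => x [Dx].
    by case=> _ qf; split => // i _; split => //; have := qf ord0 i; rewrite mxE.
  by move=> qf; split => //; split=> // i j; rewrite mxE ord1; have [] := qf j.
apply: measurableI => //; apply: fin_bigcap_measurable => [|i _] //.
by apply: mf => //; apply: open_measurable; exact: ball_open.
Qed.

End borel_rV.

Section cons_rV.
Context {R : realType} {n : nat}.

Definition cons_rV (p : R * 'rV[R]_n) : 'rV[R]_n.+1 :=
  \row_i if unlift ord0 i is Some j then p.2 ord0 j else p.1.

Definition uncons_rV (x : 'rV[R]_n.+1) : R * 'rV[R]_n :=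
  (x ord0 ord0, \row_j x ord0 (lift ord0 j)).

Lemma cons_rVK : cancel cons_rV uncons_rV.
Proof.
move=> [a x]; rewrite /uncons_rV /cons_rV mxE unlift_none; congr pair.
by apply/rowP => j; rewrite !mxE liftK.
Qed.

Lemma uncons_rVK : cancel uncons_rV cons_rV.
Proof.
move=> x; apply/rowP => i; rewrite mxE.
by case: unliftP => [j ->|->] //=; rewrite mxE.
Qed.

Lemma measurable_cons_rV : measurable_fun setT cons_rV.
Proof.
apply: measurable_fun_rV => i; under eq_fun do rewrite mxE.
case: (unlift ord0 i) => [j|]; last exact: measurable_fst.
by apply: (measurableT_comp (measurable_coord j)); exact: measurable_snd.
Qed.

Lemma measurable_uncons_rV : measurable_fun setT uncons_rV.
Proof.
apply: measurable_fun_pair; first exact: measurable_coord.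
apply: measurable_fun_rV => i; under eq_fun do rewrite mxE.
exact: measurable_coord.
Qed.

End cons_rV.

(** The image of one-dimensional Lebesgue measure times [mu] under
    [(a, x) |-> (a, x_0, ..., x_{n-1})]. *)
Section cons_measure.
Context {R : realType} {n : nat}.
Variable mu : {sigma_finite_measure set 'rV[R]_n -> \bar R}.

Definition cons_measure : set 'rV[R]_n.+1 -> \bar R :=
  pushforward (@lebesgue_measure R \x mu)%E cons_rV.

Let cons_measure0 : cons_measure set0 = 0%E.
Proof. by rewrite /cons_measure /pushforward preimage_set0 measure0. Qed.

Let cons_measure_ge0 A : (0 <= cons_measure A)%E.
Proof. by rewrite /cons_measure /pushforward. Qed.

Let cons_measure_sigma_additive : semi_sigma_additive cons_measure.
Proof.
move=> F mF tF mUF; rewrite /cons_measure /pushforward preimage_bigcup.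
have mcF A : measurable A -> measurable (@cons_rV R n @^-1` A).
  by move=> mA; rewrite -[X in measurable X]setTI; exact: measurable_cons_rV.
apply: measure_semi_sigma_additive.
- by move=> k; exact: mcF.
- apply/trivIsetP => /= i j _ _ ij; rewrite -preimage_setI.
  by move/trivIsetP : tF => /(_ _ _ _ _ ij) ->//; rewrite preimage_set0.
- by rewrite -preimage_bigcup; exact: mcF.
Qed.

HB.instance Definition _ := isMeasure.Build _ _ _ cons_measure
  cons_measure0 cons_measure_ge0 cons_measure_sigma_additive.

Let cons_measure_sigma_finite : sigma_finite setT cons_measure.
Proof.
have /sigma_finiteP[F [FT ndF Foo]] := sigma_finiteT (@lebesgue_measure R).
have /sigma_finiteP[G [GT ndG Goo]] := sigma_finiteT mu.
have FGT : \bigcup_k (F k `*` G k) = setT.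
  rewrite -setXTT FT GT predeqE => -[x y]; split.
    by move=> [k _ []/= ? ?]; split; exists k.
  move=> [/= [k _ Fx] [l _ Gy]]; exists (maxn k l) => //=; split.
  - by move: x Fx; exact/subsetPset/ndF/leq_maxl.
  - by move: y Gy; exact/subsetPset/ndG/leq_maxr.
exists (fun k => uncons_rV @^-1` (F k `*` G k)) => [|k].
  by rewrite -preimage_bigcup FGT preimage_setT.
have [mF Fkoo] := Foo k; have [mG Gkoo] := Goo k; split.
  rewrite -[X in measurable X]setTI; apply: measurable_uncons_rV => //.
  exact: measurableX.
rewrite /cons_measure /pushforward -comp_preimage.
rewrite (_ : _ \o _ = id); last by apply/funext => x /=; rewrite cons_rVK.
rewrite preimage_id product_measure1E//.
by rewrite lte_mul_pinfty// ge0_fin_numE.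
Qed.

HB.instance Definition _ := Measure_isSigmaFinite.Build _ _ _ cons_measure
  cons_measure_sigma_finite.

End cons_measure.

Fixpoint lebesgue_rV (R : realType) (n : nat) :
    {sigma_finite_measure set 'rV[R]_n -> \bar R} :=
  match n with
  | 0 => [the {sigma_finite_measure set _ -> \bar R} of \d_(0 : 'rV[R]_0)]
  | n'.+1 => [the {sigma_finite_measure set _ -> \bar R} of
               cons_measure (lebesgue_rV R n')]
  end.

Lemma lebesgue_rV_box (R : realType) n (a b : 'rV[R]_n) :
  (forall i, a ord0 i <= b ord0 i) ->
  lebesgue_rV R n [set x | forall i, a ord0 i <= x ord0 i <= b ord0 i] =
  (\prod_(i < n) (b ord0 i - a ord0 i))%:E.
Proof.
elim: n a b => [|n IH] a b ab.
  rewrite /= big_ord0 /dirac indicE (_ : _ \in _)//.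
  by apply/mem_set => -[].
rewrite big_ord_recl.
set B := [set x : 'rV[R]_n | forall i, (uncons_rV a).2 ord0 i <= x ord0 i
                                       <= (uncons_rV b).2 ord0 i].
transitivity ((@lebesgue_measure R \x lebesgue_rV R n)%E
    (`[a ord0 ord0, b ord0 ord0] `*` B)).
  apply: (congr1 (@lebesgue_measure R \x lebesgue_rV R n)%E).
  apply/seteqP; split => -[t x] /=.
    move=> h; split; first by have := h ord0; rewrite in_itv mxE unlift_none.
    by move=> i; have := h (lift ord0 i); rewrite !mxE liftK.
  rewrite in_itv /= => -[tab h] i; rewrite mxE.
  by case: unliftP => [j ->|->]//=; have := h j; rewrite !mxE.
have mB : measurable B.
  rewrite (_ : B = \bigcap_(i in [set: 'I_n]) ((fun x => x ord0 i) @^-1`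
      `[(uncons_rV a).2 ord0 i, (uncons_rV b).2 ord0 i])); last first.
    apply/seteqP; split => x.
      by move=> xB i _; rewrite /= in_itv/=; exact: xB.
    by move=> xB i; have := xB i Logic.I; rewrite /= in_itv.
  apply: fin_bigcap_measurable => // i _.
  by rewrite -[X in measurable X]setTI; exact: measurable_coord.
rewrite product_measure1E// IH; last by move=> i; rewrite !mxE.
rewrite EFinM; congr (_ * _)%E.
  transitivity (@lebesgue_measure R `[a ord0 ord0, b ord0 ord0]) => //.
  rewrite lebesgue_measure_itv/= lte_fin.
  by case: ltgtP (ab ord0) => //= ->; rewrite subrr.
by congr EFin; apply: eq_bigr => i _; rewrite !mxE.
Qed.

Section pairs.
Context {R : realType} {m : nat}.
Local Notation V := 'rV[R]_m.
Implicit Types E : set (V * V).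

Definition sublevel (W : V * V -> R) (c : R) : set (V * V) :=
  [set p | W p <= c].

Definition hat E : set (V * V) :=
  [set p | [/\ E p, E (p.1, p.1), E (p.2, p.1) & E (p.2, p.2)]].

Definition separately_convex E := forall (t : R) (p q : V * V),
  0 < t < 1 -> E p -> E q -> p.1 = q.1 \/ p.2 = q.2 ->
  E (t *: p + (1 - t) *: q).

Definition sc_hull E : set (V * V) := smallest separately_convex E.

Definition segment (a b : V) : set V :=
  [set t *: a + (1 - t) *: b | t in `[0, 1]].

Definition cube (a b : V) : set (V * V) := segment a b `*` segment a b.

Definition max_cartesian E : set (set (V * V)) :=
  [set P | exists A : set V,
    [/\ P = A `*` A, A !=set0, P `<=` E &
        forall B, A `<=` B -> B `*` B `<=` E -> B = A]].

Definition coercive (W : V * V -> R) :=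
  forall M : R, exists r : R, forall p : V * V, r < `|p| -> M < W p.

End pairs.

Section functional.
Context {R : realType} {n m : nat}.
Variable Omega : set 'rV[R]_n.
Local Notation mu := (lebesgue_rV R n).
Implicit Types u : 'rV[R]_n -> 'rV[R]_m.

(** Elements of L^oo(Omega; R^m) are given by (Borel) representatives; [Jfun]
    and [weakstar_cvg] are invariant under modification on null sets and do
    not depend on values outside [Omega]. *)
Definition Linfty u := measurable_fun Omega u /\
  exists M : R, {ae mu, forall x, Omega x -> `|u x| <= M}.

(** Outside [Omega `*` Omega] the function is set to -oo, so that this is the
    essential supremum over [Omega `*` Omega]. *)
Definition Jfun (W : 'rV[R]_m * 'rV[R]_m -> R) u : \bar R :=
  ess_sup (mu \x mu)%E
    (patch (fun=> -oo%E) (Omega `*` Omega) (fun p => (W (u p.1, u p.2))%:E)).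

(** Convergence against all functions of L^1(Omega; R^m), whose dual is
    L^oo(Omega; R^m). *)
Definition weakstar_cvg (u_ : nat -> 'rV[R]_n -> 'rV[R]_m) u :=
  forall phi : 'rV[R]_n -> 'rV[R]_m,
    (forall i, mu.-integrable Omega (fun x => (phi x ord0 i)%:E)) ->
    \int[mu]_(x in Omega) (\sum_i u_ j x ord0 i * phi x ord0 i) @[j --> \oo] -->
    \int[mu]_(x in Omega) (\sum_i u x ord0 i * phi x ord0 i).

Definition weakstar_lsc (J : ('rV[R]_n -> 'rV[R]_m) -> \bar R) :=
  forall (u_ : nat -> 'rV[R]_n -> 'rV[R]_m) u,
    (forall j, Linfty (u_ j)) -> Linfty u -> weakstar_cvg u_ u ->
    (J u <= limn_einf (fun j => J (u_ j)))%E.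

End functional.

(* Main.v *)
Require Import Defs.
From mathcomp Require Import all_boot all_order all_algebra.
From mathcomp Require Import all_classical all_reals all_analysis.
From mathcomp Require Import measurable_realfun ess_sup_inf.
From mathcomp Require Import ring lra.

Import Order.TTheory GRing.Theory Num.Theory.
Import numFieldNormedType.Exports.

Local Open Scope classical_set_scope.
Local Open Scope ring_scope.

(** Write [L c] for [sublevel W c] and [K c] for [hat (L c)].

    The essential range [S] of [u] carries almost all values of [u], and any two
    of its points are approximated by values of [u] on a product of sets of
    positive measure.  As [W] is lower semicontinuous, the functional is at most
    [c] at [u] if and only if [S `*` S] is contained in [L c], equivalently in
    [K c]; this is [Jfun_le_essential_range] and [Jfun_le_square].

    Sufficiency.  Let [u_ j] converge weakly-* to [u], with values of the
    functional at most [c] for infinitely many [j].  For these [j] the square of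
    the essential range of [u_ j] lies in [K c], hence in the separately convex
    hull, and extends by Zorn's lemma to a maximal square of the hull, which is
    a cube with ends [p j] in [K c].  Thus [u_ j] takes its values in the segment
    spanned by [p j].  By compactness the pairs [p j] have a cluster point [p] in
    [K c], and [u] takes its values in the segment spanned by [p]: a segment is a
    finite intersection of half-spaces, and half-spaces are stable under weak-*
    convergence ([weakstar_segment]).  The cube of [p] lies in [hat] of the hull,
    that is in [K c], so the functional is at most [c] at [u].

    Necessity.  It has to be shown that the cube of every [p] in [K c] lies in
    [K c].  Suppose that [A `*` A] lies in [L c].  A function equal to the
    midpoint of [a1] and [a2] on one half of [Omega], and to that of [b1] and
    [b2] on the other half, is the weak-* limit of functions that oscillate
    between [a1] and [a2], resp. [b1] and [b2]; these have values in [A].  By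
    semicontinuity the pair of midpoints lies in [L c]
    ([weakstar_lsc_midpoint]).  So a maximal [A] containing both components of
    [p], with [A `*` A] in [K c], is midpoint convex; it is also closed, hence it
    contains the segment between them ([weakstar_lsc_cube]).

    The oscillation is provided by the Rademacher functions of the first
    coordinate.  They are orthogonal with values 1 and -1 on a box around
    [Omega], so by Bessel's inequality their integrals against a bounded
    function tend to zero, and by density those against any integrable function
    do ([orthogonal_signs_weak0]). *)

(** * Maximal Cartesian subsets and segments *)

(** Zorn's lemma for the squares [B `*` B] contained in [E] with [B]
    containing [A]. *)
Lemma maximal_square_exists (T : Type) (E : set (T * T)) (A : set T) :
  A `*` A `<=` E ->
  exists B, [/\ A `<=` B, B `*` B `<=` E &
    forall C, B `<=` C -> C `*` C `<=` E -> C = B].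
Proof.
move=> AE.
(* Taking unions with [A] makes the empty chain harmless. *)
pose P := [set B | (A `|` B) `*` (A `|` B) `<=` E].
have [F FP Ftot|B [PB Bmax]] := @Zorn_bigcup T P.
- move=> [x y] [/= [Ax|[X FX Xx]] [Ay|[Y FY Yy]]].
  + exact: AE.
  + by apply: (FP _ FY); split; [left|right].
  + by apply: (FP _ FX); split; [right|left].
  + have [XY|YX] := Ftot _ _ FX FY.
    * by apply: (FP _ FY); split; right => //; exact: XY.
    * by apply: (FP _ FX); split; right => //; exact: YX.
- exists (A `|` B); split => // C ABC CE.
  have PC : P C.
    rewrite /P /= (_ : A `|` C = C)//.
    by apply/setUidPr => x Ax; apply: ABC; left.
  have BC : B `<=` C by move=> x Bx; apply: ABC; right.
  apply/seteqP; split => // x Cx; right; apply: contrapT => Bx.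
  by apply: (Bmax C) => //; split => // /(_ x Cx).
Qed.

Section cartesian.
Context {R : realType} {m : nat}.
Local Notation V := 'rV[R]_m.
Implicit Types (E : set (V * V)) (A : set V) (a b x : V).

Lemma square_hat A E : A `*` A `<=` E -> A `*` A `<=` hat E.
Proof. by move=> AE [x y] [/= Ax Ay]; split; apply: AE. Qed.

Lemma hat_sub E : hat E `<=` E.
Proof. by move=> p []. Qed.

Lemma hat_hat E : hat (hat E) = hat E.
Proof.
apply/seteqP; split => [|[x y] [/= xy xx yx yy]]; first exact: hat_sub.
by split; split.
Qed.

Lemma hatS E F : E `<=` F -> hat E `<=` hat F.
Proof. by move=> EF [x y] [] *; split; apply: EF. Qed.

Lemma sub_sc_hull E : E `<=` sc_hull E.
Proof. exact: sub_smallest. Qed.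

(** A point of the line through [a] and [b] that lies in the smallest
    coordinate box around them belongs to the segment. *)
Lemma segmentP a b x :
  (forall i, x ord0 i <= Num.max (a ord0 i) (b ord0 i)) ->
  (forall i, Num.min (a ord0 i) (b ord0 i) <= x ord0 i) ->
  (forall i j, (a ord0 j - b ord0 j) * (x ord0 i - b ord0 i) =
               (a ord0 i - b ord0 i) * (x ord0 j - b ord0 j)) ->
  segment a b x.
Proof.
move=> xM mx line.
have [ab|/existsNP[i /eqP abi]] := pselect (forall i, a ord0 i = b ord0 i).
  exists 0; first by rewrite /= in_itv/= lexx ler01.
  rewrite scale0r subr0 scale1r add0r; apply/rowP => i.
  by apply/eqP; have := xM i; have := mx i;
    rewrite ab minxx maxxx eq_le => -> ->.
exists ((x ord0 i - b ord0 i) / (a ord0 i - b ord0 i)).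
  rewrite /= in_itv/=; have := xM i; have := mx i.
  case: (ltgtP (a ord0 i) (b ord0 i)) abi => // h _ h1 h2.
    rewrite -mulrNN -invrN ler_pdivrMr ?divr_ge0//; lra.
  by rewrite ler_pdivrMr ?divr_ge0//; lra.
apply/rowP => j; rewrite !mxE.
have d0 : a ord0 i - b ord0 i != 0 by rewrite subr_eq0.
have := line i j; set d := _ - _ in d0 *; move=> h.
have -> : x ord0 j =
    b ord0 j + (a ord0 j - b ord0 j) * (x ord0 i - b ord0 i) / d.
  by rewrite h mulrAC mulfV// mul1r addrC subrK.
by field.
Qed.

End cartesian.

Section midpoint.
Context {R : realType} {m : nat}.
Local Notation V := 'rV[R]_m.

(** A closed midpoint-convex set is convex: if the points of a segment in the
    set left a gap, the midpoint of the two ends of the gap would be in it. *)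
Lemma closed_midpoint_segment (A : set V) (a b : V) : closed A ->
  (forall x y, A x -> A y -> A (2^-1 *: (x + y))) ->
  A a -> A b -> segment a b `<=` A.
Proof.
move=> cA mA Aa Ab _ [t tI <-].
pose f (s : R) : V := s *: a + (1 - s) *: b.
have cf : continuous f.
  move=> s; apply: cvgD; apply: cvgZr_tmp; first exact: cvg_id.
  by apply: cvgB; [exact: cvg_cst|exact: cvg_id].
pose S := f @^-1` A.
have cS : closed S by apply: closed_comp => // ? _; exact: cf.
have mS s s' : S s -> S s' -> S (2^-1 * (s + s')).
  move=> Ss Ss'; rewrite /S /=.
  rewrite (_ : f _ = 2^-1 *: (f s + f s')); first exact: mA.
  by apply/rowP => i; rewrite !mxE; field.
have S0 : S 0 by rewrite /S /= /f scale0r subr0 scale1r add0r.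
have S1 : S 1 by rewrite /S /= /f scale1r subrr scale0r addr0.
move: tI; rewrite /= in_itv/= => /andP[t0 t1].
apply: contrapT => St.
pose L := S `&` [set s | s <= t]; pose U := S `&` [set s | t <= s].
have supL : has_sup L by split; [exists 0|exists t => s []].
have infU : has_inf U by split; [exists 1|exists t => s []].
have cL : closed L by apply: closedI => //; exact: closed_le.
have cU : closed U by apply: closedI => //; exact: closed_ge.
have [SL Lt] : L (sup L).
  rewrite [X in X (sup L)](_ : L = closure L); last exact/closure_id.
  by apply: closure_sup; case: supL.
have [SU tU] : U (inf U).
  apply: (@itv_closed_infimums _ _ U) => //; first by case: infU.
  case: infU => U0 lU; split; first by move=> z Uz; exact: ge_inf.
  by move=> z zU; exact: lb_le_inf.
have {}Lt : sup L < t.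
  by rewrite lt_neqAle Lt andbT; apply/eqP => e; apply: St; rewrite -e in SL *.
have {}tU : t < inf U.
  by rewrite lt_neqAle tU andbT; apply/eqP => e; apply: St; rewrite e.
have Sm := mS _ _ SL SU; set c := 2^-1 * _ in Sm.
have [ct|tc] := leP c t.
  have : c <= sup L by apply: ub_le_sup => //; case: supL.
  rewrite /c; lra.
have : inf U <= c by apply: ge_inf; [case: infU|split => //; exact: ltW].
rewrite /c; lra.
Qed.

End midpoint.

(** * Bessel's inequality and weak convergence of orthogonal signs *)

Section bessel.
Import HBSimple.
Context d (T : measurableType d) (R : realType).
Variables (mu : {measure set T -> \bar R}) (D : set T).
Hypotheses (mD : measurable D) (muD : (mu D < +oo)%E).
Implicit Types f g : T -> R.

(** On the finite measure set [D] these functions form an algebra of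
    integrable functions. *)
Definition bounded_measurable f :=
  measurable_fun D f /\ exists M : R, forall x, D x -> `|f x| <= M.

Lemma bounded_measurable_integrable f :
  bounded_measurable f -> mu.-integrable D (EFin \o f).
Proof.
move=> [mf [M fM]]; apply: measurable_bounded_integrable => //.
exists M; split; first exact: num_real.
by move=> N MN x Dx /=; rewrite (le_trans (fM _ Dx))// ltW.
Qed.

Lemma bounded_measurableM f g : bounded_measurable f -> bounded_measurable g ->
  bounded_measurable (f \* g).
Proof.
move=> [mf [M fM]] [mg [N gN]]; split; first exact: measurable_funM.
by exists (M * N) => x Dx /=; rewrite normrM ler_pM// ?fM ?gN.
Qed.

Lemma bounded_measurableB f g : bounded_measurable f -> bounded_measurable g ->
  bounded_measurable (f \- g).
Proof.
move=> [mf [M fM]] [mg [N gN]]; split; first exact: measurable_funB.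
by exists (M + N) => x Dx /=; rewrite (le_trans (ler_normB _ _))// lerD ?fM ?gN.
Qed.

Lemma bounded_measurableZ (k : R) f : bounded_measurable f ->
  bounded_measurable (fun x => k * f x).
Proof.
move=> [mf [M fM]]; split; first exact: measurable_funM.
by exists (`|k| * M) => x Dx /=; rewrite normrM ler_wpM2l ?fM.
Qed.

Variable e : nat -> T -> R.
Hypotheses (me : forall j, measurable_fun D (e j))
  (e1 : forall j x, D x -> e j x * e j x = 1)
  (e_ortho : forall i j, (i < j)%N -> \int[mu]_(x in D) (e i x * e j x) = 0).

Lemma norm_sign_fun j x : D x -> `|e j x| = 1.
Proof.
move=> Dx; apply/eqP; rewrite -sqrp_eq1 ?normr_ge0// real_normK ?num_real//.
by rewrite expr2 e1.
Qed.

Lemma bounded_measurable_sign j : bounded_measurable (e j).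
Proof. by split => //; exists 1 => x Dx; rewrite norm_sign_fun. Qed.

Let bmi := bounded_measurable_integrable.
Let bmM := bounded_measurableM.
Let bmB := bounded_measurableB.
Let bmZ := bounded_measurableZ.
Let bms := bounded_measurable_sign.

Local Notation v := (fine (mu D)).
Local Notation coef f j := (\int[mu]_(y in D) (f y * e j y)).

(** What remains of [f] after subtracting its projections onto the first
    [N] functions [e j]. *)
Let residual f := fix res N : T -> R :=
  if N is N'.+1 then res N' \- (fun x => coef f N' / v * e N' x) else f.

Let residual_bm f N : bounded_measurable f -> bounded_measurable (residual f N).
Proof. by move=> bf; elim: N => [//|N IH] /=; apply: bmB => //; exact: bmZ. Qed.

Let residual_coef f N j : bounded_measurable f -> (N <= j)%N ->
  \int[mu]_(y in D) (residual f N y * e j y) = coef f j.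
Proof.
move=> bf; elim: N => [//|N IH] Nj.
rewrite -(IH (ltnW Nj)) -[RHS]subr0 -(mulr0 (coef f N / v)) -(e_ortho _ _ Nj).
rewrite -RintegralZl//; last by apply: bmi; exact: bmM.
rewrite -RintegralB//.
- by apply: eq_Rintegral => x _ /=; rewrite mulrBl mulrA.
- by apply: bmi; apply: bmM => //; exact: residual_bm.
- by apply: bmi; apply: bmZ; exact: bmM.
Qed.

Let residual_sqr f N : bounded_measurable f -> 0 < v ->
  \int[mu]_(y in D) (residual f N.+1 y * residual f N.+1 y) =
  \int[mu]_(y in D) (residual f N y * residual f N y) - coef f N ^+ 2 / v.
Proof.
move=> bf v0; have br := residual_bm f N bf.
set r := residual f N in br *; set c := coef f N.
transitivity (\int[mu]_(y in D) ((r y * r y - (2 * c / v) * (r y * e N y)) +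
   (c / v) ^+ 2)).
  apply: eq_Rintegral => x /set_mem Dx /=.
  rewrite -/c -/r.
  transitivity (r x * r x - 2 * c / v * (r x * e N x) +
    (c / v) ^+ 2 * (e N x * e N x)); last by rewrite e1// mulr1.
  by ring.
have ire : mu.-integrable D (EFin \o (fun y => r y * e N y)).
  by apply: bmi; exact: bmM.
rewrite RintegralD//; last 2 first.
- apply: bmi; apply: bmB; first exact: bmM.
  by apply: bmZ; exact: bmM.
- apply: bmi; split; first exact: measurable_cst.
  by exists `|(c / v) ^+ 2|.
rewrite RintegralB//; last 2 first.
- by apply: bmi; exact: bmM.
- by apply: bmi; apply: bmZ; exact: bmM.
rewrite RintegralZl// residual_coef// -/c Rintegral_cst//.
by field; rewrite gt_eqF.
Qed.

Lemma bessel_inequality f N : bounded_measurable f -> 0 < v ->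
  \sum_(0 <= j < N) coef f j ^+ 2 <= v * \int[mu]_(y in D) (f y * f y).
Proof.
move=> bf v0; rewrite -ler_pdivrMl// mulrC mulr_suml -subr_ge0.
suff <- : \int[mu]_(y in D) (residual f N y * residual f N y) =
   \int[mu]_(y in D) (f y * f y) - \sum_(0 <= j < N) coef f j ^+ 2 / v.
  by apply: Rintegral_ge0 => x Dx; rewrite -expr2 sqr_ge0.
elim: N => [|N IH]; first by rewrite big_geq// subr0.
by rewrite residual_sqr// IH big_nat_recr//= opprD addrA.
Qed.

Lemma bounded_coef_cvg0 f : bounded_measurable f ->
  coef f j @[j --> \oo] --> 0.
Proof.
move=> bf.
have [v0|v0] := ltP 0 v; last first.
  have D0 : mu D = 0%E.
    apply/eqP; rewrite -[mu D]fineK ?ge0_fin_numE// eqe eq_le v0 /=.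
    by rewrite fine_ge0.
  rewrite (_ : (fun _ => _) = cst 0); first exact: cvg_cst.
  apply/funext => j; rewrite /Rintegral null_set_integral//.
  by apply/measurable_EFinP; have [] := bmM _ _ bf (bms j).
have : cvgn (series (fun j => coef f j ^+ 2)).
  apply: nondecreasing_is_cvgn.
    apply/nondecreasing_seqP => j; rewrite /series/= big_nat_recr//= lerDl.
    exact: sqr_ge0.
  exists (v * \int[mu]_(y in D) (f y * f y)) => _ [N _ <-].
  exact: bessel_inequality.
move=> /cvg_series_cvg_0 c2; apply/norm_cvg0P.
rewrite (_ : (fun _ => _) = (fun j => Num.sqrt (coef f j ^+ 2))); last first.
  by apply/funext => j; rewrite sqrtr_sqr.
rewrite -[X in _ --> X]sqrtr0.
by apply: (continuous_cvg _ _ c2); exact: sqrt_continuous.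
Qed.

(** Signed functions that are pairwise orthogonal on [D] converge weakly-* to
    zero on every measurable subset of [D]. *)
Lemma orthogonal_signs_weak0 (S : set T) (g : T -> R) :
  measurable S -> S `<=` D -> mu.-integrable S (EFin \o g) ->
  \int[mu]_(x in S) (g x * e j x) @[j --> \oo] --> 0.
Proof.
move=> mS SD ig.
have meS j : measurable_fun S (e j) by exact: measurable_funS (me j).
(* Simple functions are dense in L^1, and bounded. *)
have [s_ [is_ _ sg]] := approximation_sfun_integrable mS ig.
apply/cvgrPdist_le => eps eps0.
have e20 : 0 < eps / 2 by rewrite divr_gt0.
have /fine_cvgP[_] := sg.
move=> /cvgrPdist_le /(_ _ e20)[k _ /(_ k (leqnn k))]; rewrite sub0r normrN /=.
set I := fine _ => Ik; pose s : T -> R := s_ k.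
have bs : bounded_measurable (s \_ S).
  split.
    apply: (measurable_funS measurableT) => //.
    apply/(measurable_restrictT _ mS).
    exact: measurable_funS (@measurable_funPT _ _ _ _ (s_ k)).
  have [M [_ sM]] := simple_bounded (s_ k).
  exists (M + 1) => x _; rewrite patchE; case: ifPn => _.
    by apply: sM => //; rewrite ltrDl.
  rewrite normr0.
  by apply: (le_trans (normr_ge0 (s x))); apply: sM => //; rewrite ltrDl.
have /cvgrPdist_le /(_ _ e20) := bounded_coef_cvg0 _ bs.
apply: filterS => j; rewrite !sub0r !normrN => cj.
have igs : mu.-integrable S (EFin \o (g \- s)).
  exact: (integrableB mS ig (is_ k)).
have imul (h : T -> R) : mu.-integrable S (EFin \o h) ->
    mu.-integrable S (EFin \o (fun x => h x * e j x)).
  move=> ih; apply: (le_integrable mS _ _ ih).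
    apply/measurable_EFinP/measurable_funM => //.
    by apply/measurable_EFinP; exact: measurable_int ih.
  by move=> x Sx /=; rewrite lee_fin normrM norm_sign_fun ?mulr1//; exact: SD.
have -> : \int[mu]_(x in S) (g x * e j x) =
    \int[mu]_(x in S) ((g \- s) x * e j x) + coef (s \_ S) j.
  transitivity (\int[mu]_(x in S) ((g \- s) x * e j x) +
    \int[mu]_(x in S) (s x * e j x)).
    rewrite -RintegralD//; [|exact: imul|exact: (imul s (is_ k))].
    by apply: eq_Rintegral => x _ /=; ring.
  congr (_ + _); rewrite -{1}(setIidr SD) Rintegral_mkcondr.
  apply: eq_Rintegral => x _; rewrite !patchE.
  by case: ifPn => // _; rewrite mul0r.
rewrite (le_trans (ler_normD _ _))// [leRHS]splitr lerD//.
apply: (le_trans (le_normr_Rintegral mS (imul _ igs))).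
apply: (le_trans _ (le_trans (ler_norm _) Ik)).
rewrite le_eqVlt; apply/orP; left; apply/eqP.
apply: eq_Rintegral => x /set_mem Sx.
by rewrite normrM norm_sign_fun ?mulr1//; exact: SD.
Qed.

End bessel.

(** * Rademacher functions *)

Section rademacher.
Context {R : realType}.
Local Notation lambda := (@lebesgue_measure R).

Lemma lebesgue_measure_shift (a : R) (A : set R) : measurable A ->
  lambda ((fun t => t + a) @^-1` A) = lambda A.
Proof.
move=> mA.
transitivity (pushforward lambda
  ((fun t => t + a) : _ -> measurableTypeR R) A) => //.
apply/esym/lebesgue_measure_unique => //=; first exact: measurable_funD.
move=> _ _ [[x y] _ <-]; rewrite /pushforward /=.
rewrite (_ : _ @^-1` _ = `]x - a, y - a]%classic); last first.
  by apply/seteqP; split => t; rewrite /= !in_itv/= ltrBlDr lerBrDr.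
rewrite !lebesgue_measure_itv/= !lte_fin ltrD2r.
by case: ifP => // _; rewrite !EFinN -!EFinD; congr (_%:E); lra.
Qed.

(** The square wave of period [2^(1 - j)] with values 1 and -1; the exponent
    of -1 is an integer, possibly negative. *)
Definition rademacher (j : nat) (t : R) : R := (-1) ^ Num.floor (2 ^+ j * t).

Lemma rademacher_sqr j t : rademacher j t * rademacher j t = 1.
Proof. by rewrite /rademacher -expfzMl mulrNN mulr1 exp1rz. Qed.

Lemma rademacherM_neq1 i j t : rademacher i t * rademacher j t <> 1 ->
  rademacher i t * rademacher j t = - 1.
Proof.
have := rademacher_sqr i t; have := rademacher_sqr j t.
set a := rademacher i t; set b := rademacher j t => bb aa ab1.
have : (a * b - 1) * (a * b + 1) = 0.
  by rewrite -subr_sqr expr2 mulrACA aa bb; ring.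
by move/eqP; rewrite mulf_eq0 subr_eq0 addr_eq0 => /orP[|] /eqP.
Qed.

(** Translations by multiples of [2^(-i)]: one step changes the sign of the
    [i]-th function and preserves those of larger index. *)
Lemma rademacher_shift i j k t : (i <= j)%N ->
  rademacher j (t + k%:R / 2 ^+ i) = (-1) ^+ (2 ^ (j - i) * k) * rademacher j t.
Proof.
move=> ij; rewrite /rademacher mulrDr.
have -> : 2 ^+ j * (k%:R / 2 ^+ i) = ((2 ^ (j - i) * k)%N : int)%:~R :> R.
  rewrite -pmulrn natrM natrX mulrCA mulrC.
  by congr (_ * _); rewrite expfB_cond ?ij ?orbT// pnatr_eq0.
rewrite floorDrz ?intr_int// intrKfloor expfzDr ?oppr_eq0 ?oner_eq0//.
by rewrite mulrC.
Qed.

Lemma measurable_rademacher j : measurable_fun setT (rademacher j).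
Proof.
move=> _ Y mY; rewrite setTI.
rewrite (_ : _ @^-1` Y = \bigcup_(k in [set k : int | Y ((-1) ^ k)])
   ((fun t => 2 ^+ j * t) @^-1` `[k%:~R, (k + 1)%:~R[%classic)).
  rewrite bigcup_mkcond; apply: countable_bigcupT_measurable => // k.
  case: ifPn => // _; rewrite -[X in measurable X]setTI.
  exact: measurable_funM.
apply/seteqP; split => t /=.
  move=> Yt; exists (Num.floor (2 ^+ j * t)) => //=.
  by rewrite in_itv/= floor_le lt_succ_floor.
by move=> [k /= Yk]; rewrite in_itv/= => kt; rewrite /rademacher (floor_def kt).
Qed.

Lemma measurable_rademacher_agree i j :
  measurable [set t | rademacher i t * rademacher j t = 1].
Proof.
rewrite -[X in measurable X]setTI.
have := measurable_funM (measurable_rademacher i) (measurable_rademacher j).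
by move=> /(_ measurableT _ (measurable_set1 1)).
Qed.

(** For [i < j] the translation by [2^(-i)] changes the sign of the [i]-th
    function and preserves the [j]-th one, so it exchanges the set where their
    product is 1 with its complement. *)
Lemma rademacher_balanced i j (M : nat) : (i < j)%N ->
  lambda (`[- M.+1%:R, M.+1%:R[ `&`
    [set t | rademacher i t * rademacher j t = 1]) =
  lambda (`[- M.+1%:R, M.+1%:R[ `\`
    [set t | rademacher i t * rademacher j t = 1]).
Proof.
move=> ij; set G := (X in _ `&` X); set L : R := M.+1%:R.
have mG : measurable G by exact: measurable_rademacher_agree.
pose h : R := 1 / 2 ^+ i.
have h0 : 0 < h by rewrite divr_gt0// exprn_gt0.
have h1 : h <= 1 by rewrite ler_pdivrMr ?exprn_gt0// mul1r exprn_ege1// ler1n.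
have L1 : 1 <= L by rewrite ler1n.
have Ph t : rademacher i (t + h) * rademacher j (t + h) =
    - (rademacher i t * rademacher j t).
  rewrite (rademacher_shift i i 1)//.
  rewrite (rademacher_shift i j 1)//; last exact: ltnW.
  rewrite subnn !muln1 expr1 -signr_odd oddX subn_eq0 leqNgt ij/= expr0 mul1r.
  by rewrite mulN1r mulNr.
have Gh : (fun t => t + h) @^-1` G = ~` G.
  apply/seteqP; split => t; rewrite /G/= Ph.
    by move=> + ab; rewrite ab; lra.
  by move=> /rademacherM_neq1 ->; rewrite opprK.
have P2L l t : rademacher l (t + L *+ 2) = rademacher l t.
  have -> : L *+ 2 = (2 * M.+1)%:R / 2 ^+ 0.
    by rewrite expr0 divr1 natrM mulr_natl.
  rewrite (rademacher_shift 0 l)//.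
  by rewrite -signr_odd !oddM/= andbF mul1r.
have G2L : (fun t => t + L *+ 2) @^-1` G = G.
  by apply/seteqP; split => t; rewrite /G/= !P2L.
have mI (a b : R) : measurable (`[a, b[%classic `&` G) by exact: measurableI.
have splitI (a b c : R) : a <= b -> b <= c -> lambda (`[a, c[ `&` G) =
    (lambda (`[a, b[ `&` G) + lambda (`[b, c[ `&` G))%E.
  move=> ab bc; rewrite -measureU; [|exact: mI|exact: mI|]; last first.
    rewrite -subset0 => t [[/= + _] [+ _]]; rewrite /= !in_itv/= => /andP[_ tb].
    by rewrite leNgt tb.
  rewrite -setIUl; congr (lambda (_ `&` _)); apply/seteqP; split => t/=.
    rewrite !in_itv/= => /andP[ta tc].
    by case: (ltP t b) => tb; [left|right]; exact/andP.
  rewrite !in_itv/= => -[|] /andP[ta tc]; apply/andP; split => //.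
    exact: lt_le_trans bc.
  exact: le_trans ta.
(* The windows from -L to L and from -L + h to L + h differ by a piece of
   length h that is moved by 2L, a period of both functions. *)
transitivity (lambda (`[- L + h, L + h[ `&` G)).
  rewrite (splitI (- L) (- L + h) L); [|lra|lra].
  rewrite (splitI (- L + h) L (L + h)); [|lra|lra].
  rewrite addeC; congr (_ + _)%E.
  rewrite -(lebesgue_measure_shift (L *+ 2) (`[L, L + h[ `&` G))//.
  rewrite preimage_setI G2L; congr (lambda (_ `&` _)).
  by apply/seteqP; split => t; rewrite /= !in_itv/= => /andP[? ?]; lra.
rewrite -(lebesgue_measure_shift h (`[- L + h, L + h[ `&` G))//.
rewrite preimage_setI Gh; congr (lambda (_ `&` _)).
by apply/seteqP; split => t; rewrite /= !in_itv/= lerD2r ltrD2r.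
Qed.

End rademacher.

(** * Lebesgue measure and Rademacher functions on row vectors *)

Section rV_measure.
Context {R : realType}.

Lemma rV_coord_le_norm n (x : 'rV[R]_n) i : `|x ord0 i| <= `|x|.
Proof.
rewrite -[`|x|]/(mx_norm x) mx_normrE.
exact: (le_bigmax _ (fun ij : 'I_1 * 'I_n => `|x ij.1 ij.2|) (ord0, i)).
Qed.

Lemma measurable_rV_box n (a b : 'rV[R]_n) :
  measurable [set x : 'rV[R]_n | forall i, a ord0 i <= x ord0 i <= b ord0 i].
Proof.
rewrite (_ : [set x | _] = \bigcap_(i in [set: 'I_n])
    ((fun x : 'rV[R]_n => x ord0 i) @^-1` `[a ord0 i, b ord0 i])); last first.
  apply/seteqP; split => x xB i.
    by move=> _; rewrite /= in_itv/=; exact: xB.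
  by have := xB i Logic.I; rewrite /= in_itv.
apply: fin_bigcap_measurable => // i _.
by rewrite -[X in measurable X]setTI; exact: measurable_coord.
Qed.

(** The cube [[-L, L]^n]. *)
Definition symmetric_box n (L : R) : set 'rV[R]_n :=
  [set x | forall i, - L <= x ord0 i <= L].

Let symmetric_boxE n L : symmetric_box n L =
  [set x | forall i, (const_mx (- L) : 'rV[R]_n) ord0 i <= x ord0 i <=
                     (const_mx L : 'rV[R]_n) ord0 i].
Proof. by apply/seteqP; split => x xB i; have := xB i; rewrite !mxE. Qed.

Lemma measurable_symmetric_box n L : measurable (symmetric_box n L).
Proof. by rewrite symmetric_boxE; exact: measurable_rV_box. Qed.

Lemma symmetric_box_lty n L : 0 <= L ->
  (lebesgue_rV R n (symmetric_box n L) < +oo)%E.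
Proof.
move=> L0; rewrite symmetric_boxE lebesgue_rV_box ?ltry// => i.
by rewrite !mxE; lra.
Qed.

Lemma bounded_sub_box n (S : set 'rV[R]_n) : bounded_set S ->
  exists M : nat, S `<=` symmetric_box n M%:R.
Proof.
move=> [M [_ SM]].
have [k Mk] : exists k : nat, M + 1 <= k%:R.
  exists (Num.bound `|M + 1|); rewrite (le_trans (ler_norm _))// ltW//.
  exact: archi_boundP.
exists k => x Sx i; rewrite -ler_norml (le_trans (rV_coord_le_norm _ x i))//.
by rewrite (le_trans _ Mk)//; apply: (SM (M + 1)) => //; rewrite ltrDl.
Qed.

Lemma bounded_lebesgue_rV_lty n (S : set 'rV[R]_n) :
  measurable S -> bounded_set S -> (lebesgue_rV R n S < +oo)%E.
Proof.
move=> mS /bounded_sub_box[M SM].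
apply: (@le_lt_trans _ _ (lebesgue_rV R n (symmetric_box n M%:R))).
  apply: le_measure => //; apply/mem_set => //.
  exact: measurable_symmetric_box.
by apply: symmetric_box_lty.
Qed.

Lemma open_lebesgue_rV_gt0 n (U : set 'rV[R]_n) :
  open U -> U !=set0 -> (0 < lebesgue_rV R n U)%E.
Proof.
move=> oU [x Ux].
have /nbhs_ballP[e /= e0 xeU] : nbhs x U by exact: open_nbhs_nbhs.
pose a : 'rV[R]_n := x - const_mx (e / 2).
pose b : 'rV[R]_n := x + const_mx (e / 2).
pose B := [set y : 'rV[R]_n | forall i, a ord0 i <= y ord0 i <= b ord0 i].
apply: (@lt_le_trans _ _ (lebesgue_rV R n B)).
  rewrite lebesgue_rV_box => [|i]; last by rewrite !mxE; lra.
  by rewrite lte_fin prodr_gt0// => i _; rewrite !mxE; lra.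
apply: le_measure; [apply/mem_set; exact: measurable_rV_box|
  apply/mem_set; exact: open_measurable_rV|].
move=> y By; apply: xeU; split => // i j; rewrite ord1 /ball/=.
by have := By j; rewrite !mxE ltr_norml; lra.
Qed.

Lemma lebesgue_rV_uncons n (S : set R) (B : set 'rV[R]_n) :
  measurable S -> measurable B ->
  lebesgue_rV R n.+1 (uncons_rV @^-1` (S `*` B)) =
  (@lebesgue_measure R S * lebesgue_rV R n B)%E.
Proof.
move=> mS mB; rewrite /= /cons_measure /pushforward -comp_preimage.
rewrite (_ : _ \o _ = id) ?preimage_id ?product_measure1E//.
by apply/funext => x /=; rewrite cons_rVK.
Qed.

(** The Rademacher functions of the first coordinate. *)
Definition rademacher_rV n (j : nat) (x : 'rV[R]_n.+1) : R :=
  rademacher j (x ord0 ord0).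

Lemma measurable_rademacher_rV n j : measurable_fun setT (rademacher_rV n j).
Proof.
by apply: (measurableT_comp (measurable_rademacher j)); exact: measurable_coord.
Qed.

(** The Rademacher functions converge weakly-* to zero on bounded sets: they
    are orthogonal on a large enough box. *)
Lemma rademacher_rV_weak0 n (S : set 'rV[R]_n.+1) (g : 'rV[R]_n.+1 -> R) :
  measurable S -> bounded_set S ->
  (lebesgue_rV R n.+1).-integrable S (EFin \o g) ->
  \int[lebesgue_rV R n.+1]_(x in S) (g x * rademacher_rV n j x)
    @[j --> \oo] --> 0.
Proof.
move=> mS bS ig; set mu := lebesgue_rV R n.+1.
have [M SM] := bounded_sub_box _ _ bS.
pose I : set R := `[- M.+1%:R, M.+1%:R[%classic.
pose B := symmetric_box n M.+1%:R.
pose D := @uncons_rV R n @^-1` (I `*` B).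
have mI : measurable I by exact: measurable_itv.
have mB : measurable B by exact: measurable_symmetric_box.
have muncons (A : set R) : measurable A ->
    measurable (@uncons_rV R n @^-1` (A `*` B)).
  move=> mA; rewrite -[X in measurable X]setTI.
  apply: measurable_uncons_rV => //.
  exact: measurableX.
have mD : measurable D by apply: muncons; exact: measurable_itv.
have muD : (mu D < +oo)%E.
  rewrite /mu lebesgue_rV_uncons//.
  rewrite lebesgue_measure_itv/= lte_fin.
  case: ifPn => _; last by rewrite mul0e ltry.
  apply: lte_mul_pinfty => //; last by apply: symmetric_box_lty.
  by rewrite -EFinD lee_fin opprK addr_ge0.
have MM1 : M%:R < M.+1%:R :> R by rewrite ltr_nat.
have SD : S `<=` D.
  move=> x /SM xM; split => [|i] /=.
    by rewrite /I /= in_itv/=; have := xM ord0; lra.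
  by rewrite mxE; have := xM (lift ord0 i); lra.
have mr j : measurable_fun D (rademacher_rV n j).
  by apply: measurable_funS (measurable_rademacher_rV n j).
have r1 j x : D x -> rademacher_rV n j x * rademacher_rV n j x = 1.
  by move=> _; exact: rademacher_sqr.
apply: (@orthogonal_signs_weak0 _ _ _ mu D mD muD (rademacher_rV n)) => //.
move=> i j ij.
pose G := [set t : R | rademacher i t * rademacher j t = 1].
have mG : measurable G by exact: measurable_rademacher_agree.
pose D1 := @uncons_rV R n @^-1` ((I `&` G) `*` B).
pose D2 := @uncons_rV R n @^-1` ((I `\` G) `*` B).
have mD1 : measurable D1 by apply: muncons; exact: measurableI.
have mD2 : measurable D2 by apply: muncons; exact: measurableD.
have D12 : D = D1 `|` D2.
  apply/seteqP; split => x.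
    move=> [/= Ix Bx]; have [Gx|Gx] := pselect (G (x ord0 ord0)); first by left.
    by right.
  by move=> [] [[/= Ix Gx] Bx].
have mu12 : mu D1 = mu D2.
  rewrite /mu !lebesgue_rV_uncons//; [|exact: measurableD|exact: measurableI].
  by rewrite rademacher_balanced.
rewrite D12 Rintegral_setU//; last 2 first.
- rewrite -D12; apply: (bounded_measurable_integrable _ _ _ _ _ mD muD).
  by apply: bounded_measurableM; apply: bounded_measurable_sign.
- apply/disj_setPS => x [[[_ Gx] _] [[_ nGx] _]]; exact: nGx.
rewrite (@eq_Rintegral _ _ _ _ D1 (cst 1)); last first.
  by move=> x /set_mem[[_ Gx] _].
rewrite (@eq_Rintegral _ _ _ _ D2 (cst (-1))); last first.
  move=> x /set_mem[[_ nGx] _] /=.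
  exact: rademacherM_neq1.
rewrite !Rintegral_cst//.
rewrite mulN1r mul1r; apply/eqP; rewrite subr_eq0; apply/eqP.
by congr fine; exact: mu12.
Qed.

End rV_measure.

(** * Essential range and sublevel sets of the functional *)

Section essential_range.
Context {R : realType} {m : nat} {d} {T : measurableType d}.
Variables (mu : {measure set T -> \bar R}) (Omega : set T).
Local Notation V := 'rV[R]_m.
Implicit Types (u : T -> V) (x : V).

(** The support of the image under [u] of the restriction of [mu] to
    [Omega]. *)
Definition essential_range u : set V :=
  [set x | forall U, open U -> U x -> (0 < mu (Omega `&` u @^-1` U))%E].

(** These countably many balls form a base of the topology. *)
Definition rational_ball (q : 'rV[rat]_m * nat) : set V :=
  ball (map_mx ratr q.1 : V) q.2.+1%:R^-1.

Lemma rational_ball_basis x (U : set V) : open U -> U x ->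
  exists q, rational_ball q x /\ rational_ball q `<=` U.
Proof.
move=> oU Ux.
have /nbhs_ballP[e /= e0 xeU] : nbhs x U by exact: open_nbhs_nbhs.
have [k ke] : exists k : nat, 2 / e < k.+1%:R :> R.
  exists (Num.bound (2 / e)); rewrite (@lt_trans _ _ (Num.bound (2 / e))%:R)//.
    by apply: archi_boundP; rewrite divr_ge0// ltW.
  by rewrite ltr_nat.
set r : R := k.+1%:R^-1; have r0 : 0 < r by rewrite invr_gt0.
have re : r + r <= e.
  rewrite -mulr2n -mulr_natl ler_pdivrMr// mulrC -ler_pdivrMr// ltW//.
have q_ i : exists q : rat, ball (ratr q : R) r (x ord0 i).
  have [|q] := @rat_in_itvoo R (x ord0 i - r) (x ord0 i + r); first lra.
  rewrite in_itv/= => /andP[q1 q2]; exists q.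
  by rewrite /ball/= ltr_norml; apply/andP; split; lra.
have [q qx] := choice q_.
have xq : rational_ball (\row_i q i, k) x.
  by split => // i j; rewrite !mxE ord1; exact: qx.
exists (\row_i q i, k); split => // y qy.
apply: xeU; apply: (le_ball re); apply: ball_triangle qy; exact: ball_sym.
Qed.

Lemma ae_essential_range u : measurable Omega -> measurable_fun Omega u ->
  {ae mu, forall t, Omega t -> essential_range u (u t)}.
Proof.
move=> mO mu_.
have mball q : measurable (Omega `&` u @^-1` rational_ball q).
  by apply: mu_ => //; apply: open_measurable_rV; exact: ball_open.
have : \forall t \ae mu, forall k : nat, forall q, unpickle k = Some q ->
    mu (Omega `&` u @^-1` rational_ball q) = 0%E ->
    ~ (Omega `&` u @^-1` rational_ball q) t.
  apply/ae_foralln => k.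
  case: (unpickle k) => [q|]; last by apply: nearW.
  have [q0|q0] := pselect (mu (Omega `&` u @^-1` rational_ball q) = 0%E);
      last first.
    by apply: nearW => t _ [<-].
  exists (Omega `&` u @^-1` rational_ball q); split => // t /= nt.
  by apply: contrapT => nqt; apply: nt => _ [<-] _.
apply: filterS => t ht Ot U oU Ut.
have [q [qt qU]] := rational_ball_basis _ _ oU Ut.
apply: (@lt_le_trans _ _ (mu (Omega `&` u @^-1` rational_ball q))).
  rewrite lt0e measure_ge0 andbT; apply/eqP => q0.
  exact: (ht (pickle q) q (pickleK q) q0).
apply: le_measure; [exact/mem_set|apply/mem_set|].
  by apply: mu_ => //; exact: open_measurable_rV.
by move=> s [Os qs]; split => //; exact: qU.
Qed.

Lemma ae_nonempty (P : T -> Prop) : measurable Omega -> (0 < mu Omega)%E ->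
  {ae mu, forall t, Omega t -> P t} -> exists2 t, Omega t & P t.
Proof.
move=> mO O0 [N [mN N0 PN]]; apply: contrapT => nP.
have ON : Omega `<=` N.
  by move=> t Ot; apply: PN => /(_ Ot) Pt; apply: nP; exists t.
move: O0; rewrite lt0e => /andP[/eqP + _]; apply.
exact: subset_measure0 N0.
Qed.

End essential_range.

Section Jfun_le.
Context {R : realType} {n m : nat}.
Local Notation V := 'rV[R]_m.
Local Notation mu := (lebesgue_rV R n).
Variables (Omega : set 'rV[R]_n) (W : V * V -> R).
Hypotheses (mOmega : measurable Omega)
  (W_lsc : lower_semicontinuous (EFin \o W)).
Implicit Types u : 'rV[R]_n -> V.

(** By lower semicontinuity, [c < W (x, y)] would persist on a product of
    neighbourhoods of [x] and [y], and the product of their preimages has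
    positive measure. This covers the diagonal points as well. *)
Lemma Jfun_le_essential_range u c : measurable_fun Omega u ->
  (Jfun Omega W u <= c%:E)%E ->
  essential_range mu Omega u `*` essential_range mu Omega u `<=` sublevel W c.
Proof.
move=> mfu /ess_supP [N [mN N0 WN]] [x y] [/= xr yr].
rewrite /sublevel/= leNgt; apply/negP => cW.
have [E] := W_lsc (x, y) c cW.
move=> [[U1 U2] [/= nU1 nU2] U12E] EW.
move: nU1 nU2; rewrite !nbhsE => -[U [oU Ux] UU1] [U' [oU' Uy] UU2].
have mO1 : measurable (Omega `&` u @^-1` U).
  by apply: mfu => //; exact: open_measurable_rV.
have mO2 : measurable (Omega `&` u @^-1` U').
  by apply: mfu => //; exact: open_measurable_rV.
have : (0 < (mu \x mu) ((Omega `&` u @^-1` U) `*` (Omega `&` u @^-1` U')))%E.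
  by rewrite product_measure1E// mule_gt0//; [exact: xr|exact: yr].
rewrite lt0e => /andP[/eqP + _]; apply.
apply: (subset_measure0 _ mN _ N0) => //; first exact: measurableX.
move=> [s t] [[/= Os Us] [Ot Ut]]; apply: WN => /=.
rewrite /patch mem_set//= lee_fin => Wst.
have : (c%:E < (EFin \o W) (u s, u t))%E.
  by apply: EW; apply: U12E; split => /=; [exact: UU1|exact: UU2].
by rewrite lte_fin ltNge Wst.
Qed.

Lemma Jfun_le_square u c (A : set V) :
  {ae mu, forall x, Omega x -> A (u x)} -> A `*` A `<=` sublevel W c ->
  (Jfun Omega W u <= c%:E)%E.
Proof.
move=> [N [mN N0 uN]] AW; apply/ess_supP.
have mNT : measurable (N `*` [set: 'rV[R]_n]) by exact: measurableX.
have mTN : measurable ([set: 'rV[R]_n] `*` N) by exact: measurableX.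
exists ((N `*` setT) `|` (setT `*` N)); split; first exact: measurableU.
  have {}N0 : mu N = 0%E by exact: N0.
  have NT0 : ((mu \x mu) (N `*` setT) = 0)%E.
    transitivity (mu N * mu setT)%E; first exact: product_measure1E.
    by rewrite N0 mul0e.
  have TN0 : ((mu \x mu) (setT `*` N) = 0)%E.
    transitivity (mu setT * mu N)%E; first exact: product_measure1E.
    by rewrite N0 mule0.
  by rewrite measureU0.
move=> [x y] /= nJ; apply: contrapT => /not_orP[nx ny]; apply: nJ.
rewrite /patch; case: ifPn => [/set_mem[/= Ox Oy]|_]; last by rewrite leNye.
rewrite lee_fin; apply: (AW (u x, u y)); split => /=.
  by apply: contrapT => nA; apply: nx; split => //; apply: uN => /(_ Ox).
by apply: contrapT => nA; apply: ny; split => //; apply: uN => /(_ Oy).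
Qed.

End Jfun_le.

(** * Extended real numbers *)

Lemma limn_einf_lt_frequently {R : realType} (u : nat -> \bar R) (c : \bar R)
    N :
  (limn_einf u < c)%E -> exists2 j, (N <= j)%N & (u j < c)%E.
Proof.
move=> uc; apply: contrapT => nj; move: uc; apply/negP; rewrite -leNgt.
rewrite limn_einf_lim; apply: lime_ge; first exact: is_cvg_einfs.
exists N => // k /= Nk; apply: le_ereal_inf_tmp => _ [j /= kj <-].
rewrite leNgt; apply/negP => uj; apply: nj; exists j => //.
exact: leq_trans kj.
Qed.

Lemma limn_einf_le {R : realType} (u : nat -> \bar R) (c : \bar R) :
  (forall j, (u j <= c)%E) -> (limn_einf u <= c)%E.
Proof.
move=> uc; rewrite limn_einf_lim; apply: lime_le; first exact: is_cvg_einfs.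
apply: nearW => k; apply: (le_trans _ (uc k)).
by apply: ereal_inf_lbound; exists k => /=.
Qed.

Lemma ereal_le_reals {R : realType} (x y : \bar R) :
  (forall c : R, (y < c%:E)%E -> (x <= c%:E)%E) -> (x <= y)%E.
Proof.
case: y => [y| |] h; last 2 first.
- by rewrite leey.
- case: x h => [x| |] h.
  + by have := h (x - 1) (ltNyr _); rewrite lee_fin lerBrDr gerDl ler10.
  + by have := h 0 (ltNyr _); rewrite leye_eq.
  + by rewrite leNye.
apply/lee_addgt0Pr => e e0; rewrite -EFinD; apply: h.
by rewrite lte_fin ltrDl.
Qed.


(** * Half-spaces, segments and weak-* convergence *)

(** The Euclidean inner product of row vectors. *)
Definition dot {R : realType} {m : nat} (x w : 'rV[R]_m) : R :=
  \sum_i x ord0 i * w ord0 i.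

Section dot.
Context {R : realType} {m : nat}.
Local Notation V := 'rV[R]_m.
Implicit Types (x y w : V) (a b : V).

Lemma dotD x y w : dot (x + y) w = dot x w + dot y w.
Proof.
by rewrite /dot -big_split; apply: eq_bigr => i _; rewrite mxE mulrDl.
Qed.

Lemma dotZ t x w : dot (t *: x) w = t * dot x w.
Proof. by rewrite /dot mulr_sumr; apply: eq_bigr => i _; rewrite mxE mulrA. Qed.

Lemma dot_delta x i : dot x (delta_mx ord0 i) = x ord0 i.
Proof.
rewrite /dot (bigD1 i)//= mxE !eqxx mulr1 big1 ?addr0// => j ji.
by rewrite mxE (negbTE ji) andbF mulr0.
Qed.

Lemma dot_delta2 x s t i j :
  dot x (s *: delta_mx ord0 i + t *: delta_mx ord0 j) =
  s * x ord0 i + t * x ord0 j.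
Proof.
rewrite -(dot_delta x i) -(dot_delta x j) /dot !mulr_sumr -big_split/=.
by apply: eq_bigr => k _; rewrite !mxE; ring.
Qed.

Lemma continuous_dot w : continuous (fun x => dot x w).
Proof.
move=> x; apply: (cvg_big add_continuous (nbhs_filter x)) => i _.
by apply: cvgM; [exact: coord_continuous|exact: cvg_cst].
Qed.

Lemma dot_segment a b x w : segment a b x ->
  dot x w <= Num.max (dot a w) (dot b w).
Proof.
move=> [t]; rewrite /= in_itv/= => /andP[t0 t1] <-.
rewrite dotD !dotZ; set M := Num.max _ _.
have aM : dot a w <= M by rewrite le_max lexx.
have bM : dot b w <= M by rewrite le_max lexx orbT.
have -> : M = t * M + (1 - t) * M by ring.
by rewrite lerD// ler_wpM2l// subr_ge0.
Qed.

(** A segment is an intersection of finitely many half-spaces whose normals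
    depend on its ends only. *)
Lemma segment_halfspaces a b : exists ws : 'I_m * 'I_m * bool * bool -> V,
  forall x, (forall k, dot x (ws k) <= Num.max (dot a (ws k)) (dot b (ws k))) ->
    segment a b x.
Proof.
(* The normals are the vectors [e_i] and [- e_i], which bound the coordinates,
   and the [d_j e_i - d_i e_j] with [d = a - b], orthogonal to the segment. *)
exists (fun k => let: (i, j, s, l) := k in
  if l then (a ord0 j - b ord0 j) *: delta_mx ord0 i +
            (- (a ord0 i - b ord0 i)) *: delta_mx ord0 j
  else (if s then 1 else - 1) *: delta_mx ord0 i + 0 *: delta_mx ord0 j).
move=> x xw.
apply: segmentP.
- by move=> i; have := xw (i, i, true, false);
    rewrite !dot_delta2 !mul0r !addr0 !mul1r.
- move=> i; have := xw (i, i, false, false).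
  rewrite !dot_delta2 !mul0r !addr0 !mulN1r.
  by rewrite -oppr_min lerN2.
move=> i j; apply/eqP; rewrite eq_le.
have half k l : (a ord0 l - b ord0 l) * (x ord0 k - b ord0 k) <=
    (a ord0 k - b ord0 k) * (x ord0 l - b ord0 l).
  have := xw (k, l, true, true); rewrite !dot_delta2.
  rewrite (_ : _ * a ord0 k + _ = (a ord0 l - b ord0 l) * b ord0 k +
    - (a ord0 k - b ord0 k) * b ord0 l); last by ring.
  by rewrite maxxx; lra.
by rewrite half/=; have := half j i.
Qed.

End dot.

Section integrable_dot.
Context {R : realType} {m : nat} {d} {T : measurableType d}.
Variables (mu : {measure set T -> \bar R}) (D : set T).
Hypothesis mD : measurable D.
Local Notation V := 'rV[R]_m.

Lemma measurable_rV_coord (u : T -> V) i : measurable_fun D u ->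
  measurable_fun D (fun x => u x ord0 i).
Proof. by move=> mfu; apply: (measurableT_comp (measurable_coord i)). Qed.

Lemma integrable_dot (u phi : T -> V) : measurable_fun D u ->
  (exists M : R, {ae mu, forall x, D x -> `|u x| <= M}) ->
  (forall i, mu.-integrable D (fun x => (phi x ord0 i)%:E)) ->
  mu.-integrable D (EFin \o (fun x => dot (u x) (phi x))).
Proof.
move=> mfu [M uM] iphi.
rewrite (_ : _ \o _ = (fun x => \sum_(i < m) (u x ord0 i * phi x ord0 i)%:E)%E).
  apply: integrable_sum => // i _.
  have mphi : measurable_fun D (fun x => phi x ord0 i).
    by apply/measurable_EFinP; exact: measurable_int (iphi i).
  have mup : measurable_fun D (fun x => u x ord0 i * phi x ord0 i).
    by apply: measurable_funM => //; exact: measurable_rV_coord.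
  apply/integrableP; split; first exact/measurable_EFinP.
  have /integrableP[_] := integrableZl mD M (iphi i).
  apply: le_lt_trans; apply: ae_ge0_le_integral => //.
  - by apply/measurableT_comp => //; exact/measurable_EFinP.
  - apply/measurableT_comp => //; apply/measurable_EFinP.
    exact: measurable_funM.
  apply: filterS uM => x uMx Dx /=; rewrite lee_fin !normrM ler_wpM2r//.
  rewrite (le_trans (rV_coord_le_norm _ _ _))//.
  by rewrite (le_trans (uMx Dx))// ler_norm.
by apply/funext => x /=; rewrite sumEFin.
Qed.

End integrable_dot.

Section weakstar.
Context {R : realType} {n m : nat}.
Local Notation V := 'rV[R]_m.
Local Notation mu := (lebesgue_rV R n).
Variable Omega : set 'rV[R]_n.
Hypotheses (mOmega : measurable Omega) (Omega_lty : (mu Omega < +oo)%E).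

(** Half-spaces are closed under weak-* convergence; it suffices that they
    contain the sequence approximately and along a subsequence. *)
Lemma weakstar_halfspace (u_ : nat -> 'rV[R]_n -> V) u (w : V) (b : R) :
  (forall j, Linfty Omega (u_ j)) -> Linfty Omega u ->
  weakstar_cvg Omega u_ u ->
  (forall (eps : R) N, 0 < eps -> exists2 j, (N <= j)%N &
    {ae mu, forall x, Omega x -> dot (u_ j x) w <= b + eps}) ->
  {ae mu, forall x, Omega x -> dot (u x) w <= b}.
Proof.
move=> Lu_ Lu cu freq.
have mdot v : Linfty Omega v -> measurable_fun Omega (fun x => dot (v x) w).
  move=> [mv _]; apply: measurable_sum => i; apply: measurable_funM => //.
  exact: measurable_rV_coord.
pose S := Omega `&` (fun x => dot (u x) w) @^-1` `]b, +oo[.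
have mS : measurable S by apply: (mdot _ Lu) => //; exact: measurable_itv.
have SO : S `<=` Omega by move=> x [].
have muS : (mu S < +oo)%E.
  by apply: (le_lt_trans _ Omega_lty); apply: le_measure => //; exact/mem_set.
have icst (c : R) : mu.-integrable S (EFin \o cst c).
  apply: (bounded_measurable_integrable _ _ _ _ _ mS muS); split => //.
  by exists `|c|.
have idot v : Linfty Omega v ->
    mu.-integrable S (EFin \o (fun x => dot (v x) w)).
  move=> [mv [M vM]]; apply: integrable_dot => //.
  - exact: measurable_funS mv.
  - by exists M; apply: filterS vM => x vM /SO.
  by move=> i; exact: icst.
(* The test function is [w] on the exceptional set and 0 elsewhere. *)
pose phi (x : 'rV[R]_n) : V := if x \in S then w else 0.
have phiE (v : 'rV[R]_n -> V) :
    \int[mu]_(x in Omega) (\sum_i v x ord0 i * phi x ord0 i) =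
    \int[mu]_(x in S) dot (v x) w.
  rewrite -[in RHS](setIidr SO) Rintegral_mkcondr.
  apply: eq_Rintegral => x _; rewrite patchE /phi; case: ifPn => // _.
  by rewrite big1// => i _; rewrite mxE mulr0.
have : \int[mu]_(x in S) dot (u_ j x) w @[j --> \oo] -->
    \int[mu]_(x in S) dot (u x) w.
  have := cu phi; rewrite phiE; under eq_fun do rewrite phiE; apply => i.
  apply: (bounded_measurable_integrable _ _ _ _ _ mOmega Omega_lty
    (fun x => phi x ord0 i)).
  have -> : (fun x => phi x ord0 i) = cst (w ord0 i) \_ S.
    by apply/funext => x; rewrite patchE /phi; case: ifPn => //; rewrite mxE.
  split.
    apply: (measurable_funS measurableT) => //.
    exact/(measurable_restrictT _ mS).
  by exists `|w ord0 i| => x _; rewrite patchE; case: ifPn; rewrite ?normr0.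
move=> cS.
have intS : \int[mu]_(x in S) (dot (u x) w - b) <= 0.
  rewrite RintegralB//; [|exact: idot|exact: icst].
  rewrite Rintegral_cst// subr_le0; apply/ler_addgt0Pr => e e0.
  pose s := fine (mu S).
  have s0 : 0 <= s by exact: fine_ge0.
  pose e' := e / (s + 1).
  have e'0 : 0 < e' by rewrite divr_gt0// ltr_pwDr.
  have /cvgrPdist_le /(_ _ e'0)[N _ SN] := cS.
  have [j Nj uj] := freq _ N e'0.
  have := SN j Nj; rewrite ler_norml => /andP[_ Ij].
  have : 0 <= \int[mu]_(x in S) (b + e' - dot (u_ j x) w).
    have mh : measurable_fun S (fun x => b + e' - dot (u_ j x) w).
      by apply: measurable_funB => //; exact: measurable_funS (mdot _ (Lu_ j)).
    rewrite (_ : \int[mu]_(x in S) _ =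
      \int[mu]_(x in S) `|b + e' - dot (u_ j x) w|).
      by apply: Rintegral_ge0 => x _; exact: normr_ge0.
    congr fine; apply: ae_eq_integral => //.
    - exact/measurable_EFinP.
    - by apply/measurable_EFinP; exact: measurableT_comp.
    by apply: filterS uj => x uj /SO /uj ujx /=; rewrite ger0_norm// subr_ge0.
  rewrite RintegralB//; [|exact: icst|exact: idot].
  rewrite Rintegral_cst// -/s => h.
  have -> : e = e' * s + e' by rewrite /e'; field; rewrite gt_eqF// ltr_pwDr.
  by move: h Ij; rewrite mulrDl; lra.
have mub : measurable_fun S (EFin \o (fun x => dot (u x) w - b)).
  apply/measurable_EFinP/measurable_funB => //.
  exact: measurable_funS (mdot _ Lu).
have ub x : S x -> b < dot (u x) w by move=> [_]; rewrite /= in_itv/= andbT.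
have : (\int[mu]_(x in S) `|(EFin \o (fun x => dot (u x) w - b)%R) x| = 0)%E.
  have iub : mu.-integrable S (EFin \o (fun x => dot (u x) w - b)).
    exact: (integrableB mS (idot _ Lu) (icst b)).
  rewrite (@eq_integral _ _ _ _ _ (fun x => (dot (u x) w - b)%:E)); last first.
    by move=> x /set_mem Sx /=; rewrite ger0_norm// subr_ge0 ltW// ub.
  apply/eqP; rewrite eq_le; apply/andP; split.
    rewrite -[leLHS]fineK; first by rewrite lee_fin.
    exact: integrable_fin_num.
  by apply: integral_ge0 => x Sx /=; rewrite lee_fin subr_ge0 ltW// ub.
move=> /ae_eq_integral_abs => /(_ mS mub).
apply: filterS => x Sx Ox; rewrite leNgt; apply/negP => bx.
have /Sx[/eqP] : S x by split => //; rewrite /= in_itv/= bx.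
by rewrite subr_eq0 gt_eqF.
Qed.

End weakstar.

Section weakstar_segment.
Context {R : realType} {n m : nat}.
Local Notation V := 'rV[R]_m.
Local Notation mu := (lebesgue_rV R n).
Variable Omega : set 'rV[R]_n.
Hypotheses (mOmega : measurable Omega) (Omega_lty : (mu Omega < +oo)%E).

(** If the members of a subsequence take values in segments whose pairs of
    ends stay in a compact set, the weak-* limit takes values in the segment
    given by a cluster point of these pairs. *)
Lemma weakstar_segment (K : set (V * V)) u_ u :
  compact K ->
  (forall j, Linfty Omega (u_ j)) -> Linfty Omega u ->
  weakstar_cvg Omega u_ u ->
  (forall N, exists j, (N <= j)%N /\ exists2 p : V * V, K p &
    {ae mu, forall x, Omega x -> segment p.1 p.2 (u_ j x)}) ->
  exists2 p : V * V, K p & {ae mu, forall x, Omega x -> segment p.1 p.2 (u x)}.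
Proof.
move=> cK Lu_ Lu cu freq.
have freq2 N : exists jp : nat * (V * V), [/\ (N <= jp.1)%N, K jp.2 &
    {ae mu, forall x, Omega x -> segment jp.2.1 jp.2.2 (u_ jp.1 x)}].
  by have [j [Nj [p Kp pj]]] := freq N; exists (j, p).
have {freq freq2}[jp jpP] := choice freq2.
pose p_ N := (jp N).2.
have [q [Kq clq]] : K `&` cluster (p_ @ \oo) !=set0.
  by apply: cK; exists 0%N => // N _; have [] := jpP N.
exists q => //.
have [ws wsP] := segment_halfspaces q.1 q.2.
have wu k : {ae mu, forall x, Omega x ->
    dot (u x) (ws k) <= Num.max (dot q.1 (ws k)) (dot q.2 (ws k))}.
  apply: (weakstar_halfspace _ mOmega Omega_lty _ _ _ _ Lu_ Lu cu).
  move=> eps N eps0.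
  have c1 : (fun p : V * V => dot p.1 (ws k)) @ q --> dot q.1 (ws k).
    apply: (@cvg_comp _ _ _ fst (fun x => dot x (ws k))); first exact: cvg_fst.
    exact: continuous_dot.
  have c2 : (fun p : V * V => dot p.2 (ws k)) @ q --> dot q.2 (ws k).
    apply: (@cvg_comp _ _ _ snd (fun x => dot x (ws k))); first exact: cvg_snd.
    exact: continuous_dot.
  move/cvgrPdist_le : c1 => /(_ _ eps0) c1.
  move/cvgrPdist_le : c2 => /(_ _ eps0) c2.
  have pN : (p_ @ \oo) [set p_ k | k in [set k | (N <= k)%N]].
    by exists N => // l /= Nl; exists l.
  have [_ [[l /= Nl <-] [d1 d2]]] := clq _ _ pN (filterI c1 c2).
  have [lj _ useg] := jpP l.
  exists (jp l).1; first exact: leq_trans lj.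
  apply: filterS useg => x + Ox => /(_ Ox) /(@dot_segment _ _ _ _ _ (ws k)).
  move=> /le_trans; apply; rewrite -/(p_ l) ge_max.
  set a := dot q.1 _ in d1 *; set b := dot q.2 _ in d2 *.
  have aM : a <= Num.max a b by rewrite le_max lexx.
  have bM : b <= Num.max a b by rewrite le_max lexx orbT.
  move: d1 d2; rewrite /= !ler_distlC => /andP[_ d1] /andP[_ d2].
  by apply/andP; split; lra.
have : {ae mu, forall x, forall k, Omega x ->
    dot (u x) (ws k) <= Num.max (dot q.1 (ws k)) (dot q.2 (ws k))}.
  exact: filter_forall.
by apply: filterS => x ux Ox; apply: wsP => k; exact: ux.
Qed.

End weakstar_segment.

(** * Sufficiency *)

Section sufficiency.
Context {R : realType} {n m : nat}.
Local Notation V := 'rV[R]_m.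
Local Notation mu := (lebesgue_rV R n).
Variables (Omega : set 'rV[R]_n) (W : V * V -> R).
Hypotheses (mOmega : measurable Omega) (Omega_lty : (mu Omega < +oo)%E)
  (Omega_gt0 : (0 < mu Omega)%E) (W_lsc : lower_semicontinuous (EFin \o W)).

(** It suffices for weak-* lower semicontinuity that every non-empty square in
    [hat (sublevel W c)] lies in the cube of a pair of this set, and that the
    cubes of all its pairs are contained in it. *)
Lemma Jfun_weakstar_lsc :
  (forall c, compact (hat (sublevel W c))) ->
  (forall c, forall A : set V, A !=set0 -> A `*` A `<=` hat (sublevel W c) ->
    exists2 p, hat (sublevel W c) p & A `<=` segment p.1 p.2) ->
  (forall c p, hat (sublevel W c) p -> cube p.1 p.2 `<=` hat (sublevel W c)) ->
  weakstar_lsc Omega (Jfun Omega W).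
Proof.
move=> cK squareP cubeP u_ u Lu_ Lu cu.
apply: ereal_le_reals => c lc.
have [|q Kq qu] := weakstar_segment _ mOmega Omega_lty _ u_ u (cK c) Lu_ Lu cu.
  move=> N; have [j Nj jc] := limn_einf_lt_frequently _ _ N lc.
  exists j; split => //.
  have [muj _] := Lu_ j.
  have sq := Jfun_le_essential_range _ _ mOmega W_lsc _ _ muj (ltW jc).
  have aej := ae_essential_range mu _ _ mOmega muj.
  have [|p Kp pA] := squareP c _ _ (square_hat _ _ sq).
    by have [x _ xA] := ae_nonempty _ _ _ mOmega Omega_gt0 aej; exists (u_ j x).
  by exists p => //; apply: filterS aej => x + Ox => /(_ Ox) /pA.
apply: (Jfun_le_square _ _ _ _ _ qu) => p pA.
by have [] := cubeP c q Kq p pA.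
Qed.

End sufficiency.

(** * Necessity *)

Section necessity.
Context {R : realType} {n m : nat}.
Local Notation V := 'rV[R]_m.
Local Notation mu := (lebesgue_rV R n.+1).
Variables (Omega : set 'rV[R]_n.+1) (W : V * V -> R).
Hypotheses (Omega_neq0 : Omega !=set0) (Omega_bounded : bounded_set Omega)
  (Omega_open : open Omega) (W_lsc : lower_semicontinuous (EFin \o W))
  (J_lsc : weakstar_lsc Omega (Jfun Omega W)).

Let mOmega : measurable Omega.
Proof. exact: open_measurable_rV. Qed.

(** If [J] is weakly-* lower semicontinuous, then the square of a set in a
    sublevel set of [W] may be enlarged by midpoints: a function equal to two
    midpoints on two halves of [Omega] is the weak-* limit of functions that
    oscillate between the corresponding ends. *)
Lemma weakstar_lsc_midpoint c (A : set V) a1 a2 b1 b2 :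
  A `*` A `<=` sublevel W c -> A a1 -> A a2 -> A b1 -> A b2 ->
  sublevel W c (2^-1 *: (a1 + a2), 2^-1 *: (b1 + b2)).
Proof.
move=> AW Aa1 Aa2 Ab1 Ab2.
have [z Oz] := Omega_neq0.
pose H (x : 'rV[R]_n.+1) := x ord0 ord0 < z ord0 ord0.
(* The two halves of [Omega] are cut along the hyperplane through [z]. *)
pose sel (a b : V) (x : 'rV[R]_n.+1) : V := if H x then a else b.
pose mid := sel (2^-1 *: (a1 + a2)) (2^-1 *: (b1 + b2)).
pose dif := sel (2^-1 *: (a1 - a2)) (2^-1 *: (b1 - b2)).
pose r := @rademacher_rV R n.
pose u_ j x := mid x + r j x *: dif x.
have mH : measurable_fun setT H.
  by apply: measurable_fun_ltr; [exact: measurable_coord|exact: measurable_cst].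
have msel a b : measurable_fun setT (sel a b) by exact: measurable_fun_ifT.
have mO (f : 'rV[R]_n.+1 -> V) :
    measurable_fun setT f -> measurable_fun Omega f.
  exact: measurable_funS.
have mmid : measurable_fun setT mid by exact: msel.
have mdif : measurable_fun setT dif by exact: msel.
have sel_le a b x : `|sel a b x| <= `|a| + `|b|.
  by rewrite /sel; case: ifP => _; rewrite ?lerDl ?lerDr.
have r1 j x : r j x = 1 \/ r j x = -1.
  have /eqP : r j x * r j x = 1 by exact: rademacher_sqr.
  by rewrite -expr2 sqrf_eq1 => /orP[] /eqP; [left|right].
have rabs j x : `|r j x| = 1 by case: (r1 j x) => ->; rewrite ?normrN normr1.
have mr_dif j : measurable_fun setT (fun x => r j x *: dif x).
  apply: measurable_fun_rV => i; under eq_fun do rewrite mxE.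
  apply: measurable_funM; first exact: measurable_rademacher_rV.
  by apply: (measurable_rV_coord _ dif); exact: mdif.
have mu_ j : measurable_fun setT (u_ j).
  apply: measurable_fun_rV => i; under eq_fun do rewrite mxE.
  apply: measurable_funD.
    by apply: (measurable_rV_coord _ mid); exact: mmid.
  by apply: (measurable_rV_coord _ (fun x => r j x *: dif x)); exact: mr_dif.
have uA j x : A (u_ j x).
  rewrite /u_ /mid /dif /sel; case: ifP => _; case: (r1 j x) => ->;
    rewrite ?scaleN1r ?scale1r -?scalerBr -?scalerDr.
  - by rewrite (_ : 2^-1 *: _ = a1)//; apply/rowP => i; rewrite !mxE; field.
  - by rewrite (_ : 2^-1 *: _ = a2)//; apply/rowP => i; rewrite !mxE; field.
  - by rewrite (_ : 2^-1 *: _ = b1)//; apply/rowP => i; rewrite !mxE; field.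
  - by rewrite (_ : 2^-1 *: _ = b2)//; apply/rowP => i; rewrite !mxE; field.
have [Md dM] : exists M : R, forall x, `|dif x| <= M.
  by eexists => x; exact: sel_le.
have [Mm mM] : exists M : R, forall x, `|mid x| <= M.
  by eexists => x; exact: sel_le.
have Lu_ j : Linfty Omega (u_ j).
  split; first exact: mO.
  exists (Mm + Md); apply: nearW => x _; rewrite (le_trans (ler_normD _ _))//.
  by rewrite lerD// normrZ rabs mul1r.
have Lmid : Linfty Omega mid.
  by split; [exact: mO|exists Mm; exact: nearW].
have cu : weakstar_cvg Omega u_ mid.
  move=> phi iphi.
  have imid : mu.-integrable Omega (EFin \o (fun x => dot (mid x) (phi x))).
    by apply: integrable_dot => //; [case: Lmid|exists Mm; exact: nearW].
  have idif : mu.-integrable Omega (EFin \o (fun x => dot (dif x) (phi x))).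
    apply: integrable_dot => //; first exact: mO.
    by exists Md; exact: nearW.
  have irdif j : mu.-integrable Omega
      (EFin \o (fun x => dot (r j x *: dif x) (phi x))).
    apply: integrable_dot => //; first exact: mO.
    by exists Md; apply: nearW => x _; rewrite normrZ rabs mul1r.
  have -> : (fun j =>
      \int[mu]_(x in Omega) (\sum_i u_ j x ord0 i * phi x ord0 i)) =
      (fun j => \int[mu]_(x in Omega) dot (mid x) (phi x) +
        \int[mu]_(x in Omega) (dot (dif x) (phi x) * r j x)).
    apply/funext => j; rewrite -[X in _ + X](_ : \int[mu]_(x in Omega)
      dot (r j x *: dif x) (phi x) = _); last first.
      by apply: eq_Rintegral => x _; rewrite dotZ mulrC.
    rewrite -RintegralD//.
    by apply: eq_Rintegral => x _; rewrite -dotD.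
  rewrite -[X in _ --> X]addr0; apply: cvgD; first exact: cvg_cst.
  exact: rademacher_rV_weak0.
have Jmid : (Jfun Omega W mid <= c%:E)%E.
  apply: (le_trans (J_lsc _ _ Lu_ Lmid cu)); apply: limn_einf_le => j.
  by apply: (Jfun_le_square _ _ _ _ _ _ AW); apply: nearW => x _; exact: uA.
have Hopen : open (H : set _).
  apply: (@open_comp _ _ (fun x : 'rV[R]_n.+1 => x ord0 ord0)
    [set t | t < z ord0 ord0]).
    by move=> x _; exact: coord_continuous.
  exact: open_lt.
have Hopen' : open [set x : 'rV[R]_n.+1 | z ord0 ord0 < x ord0 ord0].
  apply: (@open_comp _ _ (fun x : 'rV[R]_n.+1 => x ord0 ord0)
    [set t | z ord0 ord0 < t]).
    by move=> x _; exact: coord_continuous.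
  exact: open_gt.
have /nbhs_ballP[e /= e0 zeO] : nbhs z Omega by exact: open_nbhs_nbhs.
have ballz (s : R) : `|s| < e -> Omega (z + const_mx s).
  move=> se; apply: zeO; split => // i j.
  by rewrite /ball/= !mxE opprD addrA subrr sub0r normrN.
have e2 : `|e / 2| < e by rewrite ger0_norm ?divr_ge0 ?ltW//; lra.
have mid_range (G : set 'rV[R]_n.+1) v : open G -> (Omega `&` G) !=set0 ->
    (forall x, G x -> mid x = v) -> essential_range mu Omega mid v.
  move=> oG OG Gv U oU Uv.
  apply: (lt_le_trans (open_lebesgue_rV_gt0 _ _ (openI Omega_open oG) OG)).
  apply: le_measure; rewrite ?inE.
  - by apply: open_measurable_rV; exact: openI.
  - by case: Lmid => + _; apply => //; exact: open_measurable_rV.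
  by move=> x [Ox Gx]; split => //; rewrite /= Gv.
have := Jfun_le_essential_range _ _ mOmega W_lsc _ _ (proj1 Lmid) Jmid.
apply; split => /=.
  apply: (mid_range _ _ Hopen) => [|x]; last by rewrite /mid /sel => ->.
  exists (z + const_mx (- (e / 2))); split; first by apply: ballz; rewrite normrN.
  by rewrite /H !mxE; lra.
apply: (mid_range _ _ Hopen') => [|x /= zx].
  exists (z + const_mx (e / 2)); split; first exact: ballz.
  by rewrite /= !mxE; lra.
by rewrite /mid /sel /H ltNge (ltW zx).
Qed.

(** A maximal square of [hat (sublevel W c)] that contains [p] and its
    reflection has a closed and midpoint convex, hence convex, side. *)
Lemma weakstar_lsc_cube c p : closed (hat (sublevel W c)) ->
  hat (sublevel W c) p -> cube p.1 p.2 `<=` hat (sublevel W c).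
Proof.
set K := hat _ => cK Kp.
have pairK : [set p.1; p.2] `*` [set p.1; p.2] `<=` K.
  move: Kp; rewrite -[K]hat_hat; case: p => a b [/= ab aa ba bb] [x y] /=.
  by move=> [[->|->] [->|->]].
have [A [pA AK Amax]] := maximal_square_exists _ _ _ pairK.
have enlarge B : A `<=` B -> B `*` B `<=` K -> B `<=` A.
  by move=> AB BK; rewrite (Amax _ AB BK).
have cA : closed A.
  apply/closure_id/seteqP; split; first exact: subset_closure.
  apply: enlarge; first exact: subset_closure.
  move=> [x y] [/= clx cly]; apply: cK => B [[U U'] [/= nU nU'] UB].
  have [x' [Ax' Ux']] := clx _ nU; have [y' [Ay' Uy']] := cly _ nU'.
  by exists (x', y'); split; [exact: AK|exact: UB].
have mA x y : A x -> A y -> A (2^-1 *: (x + y)).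
  move=> Ax Ay.
  pose B := [set 2^-1 *: (q.1 + q.2) | q in A `*` A].
  have AB : A `<=` B.
    by move=> v Av; exists (v, v) => //; apply/rowP => i; rewrite !mxE/=; field.
  apply: (enlarge _ AB); last by exists (x, y).
  apply: square_hat => -[v w] [/= [[a1 a2] [/= Aa1 Aa2] <-]].
  move=> [[b1 b2] [/= Ab1 Ab2] <-].
  by apply: (weakstar_lsc_midpoint _ A) => // q /AK; exact: hat_sub.
have segA : segment p.1 p.2 `<=` A.
  by apply: closed_midpoint_segment => //; apply: pA; [left|right].
by move=> q [q1 q2]; apply: AK; split; exact: segA.
Qed.

End necessity.

(** * The characterization of weak-* lower semicontinuity *)

Theorem corollary7p2 (R : realType) (n m : nat) (n_gt0 : (0 < n)%N)
  (m_gt0 : (0 < m)%N) (Omega : set 'rV[R]_n)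
  (Omega_neq0 : Omega !=set0) (Omega_bounded : bounded_set Omega)
  (Omega_open : open Omega)
  (W : 'rV[R]_m * 'rV[R]_m -> R)
  (W_lsc : lower_semicontinuous (EFin \o W)) (W_coercive : coercive W)
  (hat_compact : forall c : R, compact (hat (sublevel W c)))
  (hat_hull : forall c : R, hat (sc_hull (hat (sublevel W c))) =
     \bigcup_(p in hat (sublevel W c)) cube p.1 p.2)
  (max_cartesian_hull : forall c : R,
     max_cartesian (sc_hull (hat (sublevel W c))) `<=`
     [set cube p.1 p.2 | p in hat (sublevel W c)]) :
  weakstar_lsc Omega (Jfun Omega W) <->
  forall c : R, hat (sc_hull (hat (sublevel W c))) = hat (sublevel W c).
Proof.
have mOmega : measurable Omega by exact: open_measurable_rV.
split=> [J_lsc c|hullE].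
  case: n n_gt0 Omega Omega_neq0 Omega_bounded Omega_open J_lsc mOmega => // n _.
  move=> Omega Omega_neq0 Omega_bounded Omega_open J_lsc mOmega.
  apply/seteqP; split.
    rewrite hat_hull => q [p Kp].
    apply: (weakstar_lsc_cube _ _ Omega_neq0 Omega_bounded Omega_open
      W_lsc J_lsc) => //.
    by apply: compact_closed; [exact: norm_hausdorff|exact: hat_compact].
  by rewrite -[X in X `<=` _]hat_hat; apply: hatS; exact: sub_sc_hull.
apply: Jfun_weakstar_lsc => //.
- exact: bounded_lebesgue_rV_lty.
- exact: open_lebesgue_rV_gt0.
- move=> c A [x Ax] AK.
  have [B [AB BE Bmax]] :=
    maximal_square_exists _ _ _ (subset_trans AK (sub_sc_hull _)).
  have [p Kp pB] : [set cube p.1 p.2 | p in hat (sublevel W c)] (B `*` B).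
    by apply: max_cartesian_hull; exists B; split => //; exists x; exact: AB.
  exists p => // y Ay.
  have : cube p.1 p.2 (y, y) by rewrite pB; split; exact: AB.
  by case.
- by move=> c p Kp; rewrite -hullE hat_hull => q pq; exists p.
Qed.
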